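(* Let $R$ be a discrete valuation ring with fraction field $K$, maximal ideal $\mathfrak{m}$, valuation $v_R$, residue field $\kappa$ and uniformiser $t$. Let $A_1,A_2,B_1,B_2\subset\mathbb{P}^n_K$ be a (non-degenerate) complementary configuration of type $(k,n)$, let $\underline A_i,\underline B_j\subset\mathbb{P}^n_R$ be their Zariski closures, and let $A_i^s,B_j^s\subset\mathbb{P}^n_\kappa$ be the special fibres of the closures. Let $\mathfrak{c}_{\mathrm{lim}}$ be the limit perturbation induced by the family. Then $$\mathrm{reg}_t\,(A_1,A_2;B_1,B_2)=(A_1^s,A_2^s;B_1^s,B_2^s)_{\mathfrak{c}_{\mathrm{lim}}}\in\kappa^\times.$$
   Context: Notation: $\det W=\bigwedge^{\dim W}W$ (so $\det 0$ is the base field), and $\hat A$ denotes the linear subspace of the ambient vector space whose projectivisation is $A$. **Regularised limit.** $\mathrm{reg}_t:K^\times\to\kappa^\times$, $\mathrm{reg}_t(x)=t^{-v_R(x)}x\bmod\mathfrak{m}$. **Cross-ratio.** A complementary configuration of type $(k,n)$ over a field $K$ is a quadruple of linear subspaces $A_1,A_2,B_1,B_2\subset\mathbb{P}(V)$, $\dim V=n+1$, with $\dim A_i=k$, $\dim B_j=n-k-1$, $A_i\cap B_j=\emptyset$ for all $i,j$. With generators $a_i\in\det\hat A_i$, $b_j\in\det\hat B_j$, its cross-ratio is $$(A_1,A_2;B_1,B_2)=\frac{a_1\wedge b_1}{a_1\wedge b_2}\,\frac{a_2\wedge b_2}{a_2\wedge b_1}\in K^\times$$ (ratios taken in the line $\det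 V$). **Degenerate cross-ratio.** A degenerate complementary configuration is the same without any assumption on $A_i\cap B_j$. Put $\hat S_{ij}=\hat A_i\cap\hat B_j$ and $\hat Q_{ij}=V/(\hat A_i+\hat B_j)$. There is a canonical isomorphism $$\det\hat A_i\otimes\det\hat B_j\otimes\mathrm{Hom}(\det\hat S_{ij},\det\hat Q_{ij})\xrightarrow{\ \sim\ }\det V\qquad( * )$$ given by $a\otimes b\otimes\phi\mapsto a\wedge b'\wedge\phi(s)$, where $s$ generates $\det\hat S_{ij}$, $\hat B_j=B'\oplus\hat S_{ij}$, and $b'\in\det B'$ is such that $b=b'\wedge s$. Given $\mathfrak{c}=(\mathfrak{c}_{11},\mathfrak{c}_{12},\mathfrak{c}_{21},\mathfrak{c}_{22})$ with $0\ne\mathfrak{c}_{ij}\in\mathrm{Hom}(\det\hat S_{ij},\det\hat Q_{ij})$, define $$(A_1,A_2;B_1,B_2)_{\mathfrak{c}}=\frac{a_1\otimes b_1\otimes\mathfrak{c}_{11}}{a_1\otimes b_2\otimes\mathfrak{c}_{12}}\,\frac{a_2\otimes b_2\otimes\mathfrak{c}_{22}}{a_2\otimes b_1\otimes\mathfrak{c}_{21}},$$ the ratios being computed in $\det V$ via $( * )$; this is independent of the generators $a_i,b_j$. **Limit perturbation.** Let $\mathcal{V}=R^{n+1}$, $V=K^{n+1}$, $V^s=\kappa^{n+1}$. For each $(i,j)$ let $\hat{\mathcal{A}}_i=\hat A_i\cap\mathcal{V}$, $\hat{\mathcal{B}}_j=\hat B_j\cap\mathcal{V}$, so that $\hat A_i^s=\hat{\mathcal{A}}_i\otimes_R\kappa$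 and $\hat B_j^s=\hat{\mathcal{B}}_j\otimes_R\kappa$. Let $\Psi_{ij}:\hat{\mathcal{A}}_i\oplus\hat{\mathcal{B}}_j\to\mathcal{V}$ be the sum of the inclusions, $\det\Psi_{ij}:\det\hat{\mathcal{A}}_i\otimes\det\hat{\mathcal{B}}_j\to\det\mathcal{V}$, and let $v_R(\det\Psi_{ij})$ be its valuation with respect to $R$-bases. Then $\mathrm{reg}_t\det\Psi_{ij}:=\big(t^{-v_R(\det\Psi_{ij})}\det\Psi_{ij}\bmod\mathfrak{m}\big):\det\hat A_i^s\otimes\det\hat B_j^s\to\det V^s$ is an isomorphism. Via $( * )$ over $\kappa$ it corresponds to a unique non-zero $\mathfrak{c}_{\mathrm{lim},ij}\in\mathrm{Hom}(\det\hat S_{ij},\det\hat Q_{ij})$, where $\hat S_{ij}=\hat A_i^s\cap\hat B_j^s$, $\hat Q_{ij}=V^s/(\hat A_i^s+\hat B_j^s)$; i.e. $a\otimes b\otimes\mathfrak{c}_{\mathrm{lim},ij}\mapsto(\mathrm{reg}_t\det\Psi_{ij})(a\otimes b)$ under $( * )$. Set $\mathfrak{c}_{\mathrm{lim}}=(\mathfrak{c}_{\mathrm{lim},ij})_{i,j}$. *)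

(* Defs.v *)
From HB Require Import structures.
From mathcomp Require Import all_boot all_order all_algebra.
From mathcomp Require Export mpoly.
From Stdlib Require Import ClassicalEpsilon.

Set Implicit Arguments.
Unset Strict Implicit.
Unset Printing Implicit Defensive.

Import GRing.Theory Num.Theory.
Local Open Scope ring_scope.

(* The exterior algebra of F^m: the coordinate at I = {i_1 < ... < i_p} is    *)
(* the coefficient of e_I = e_{i_1} /\ ... /\ e_{i_p}.                        *)
Notation ext F m := {ffun {set 'I_m} -> F^o}.

Section Exterior.
Variables (F : comNzRingType) (m : nat).
Implicit Types (u v w : ext F m) (I J K L : {set 'I_m}).

(* For disjoint J and L, e_J /\ e_L = (-1) ^ (inversions J L) e_(J u L).      *)
Definition inversions J L : nat := \sum_(j in J) \sum_(l in L) (l < j)%N.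

Definition wedge u v : ext F m :=
  [ffun I : {set 'I_m} => \sum_(J : {set 'I_m} | J \subset I)
     (-1) ^+ inversions J (I :\: J) * ((u J : F) * (v (I :\: J) : F))].

Definition ext1 : ext F m := [ffun I : {set 'I_m} => (I == set0)%:R].

Definition ext_top : ext F m := [ffun I : {set 'I_m} => (I == setT)%:R].

Definition ext_vec (x : 'rV[F]_m) : ext F m :=
  [ffun I : {set 'I_m} => \sum_(i | I == [set i]) x 0 i].

Definition wedge_rows p (X : 'M[F]_(p, m)) : ext F m :=
  \big[wedge/ext1]_(i < p) ext_vec (row i X).

Lemma inversionsUl J K L : [disjoint J & K] ->
  inversions (J :|: K) L = (inversions J L + inversions K L)%N.
Proof.
by move=> dJK; rewrite /inversions -bigU //; apply: eq_bigl => j; rewrite !inE.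
Qed.

Lemma inversionsUr J K L : [disjoint K & L] ->
  inversions J (K :|: L) = (inversions J K + inversions J L)%N.
Proof.
move=> dKL; rewrite /inversions -big_split; apply: eq_bigr => j _.
by rewrite -bigU //; apply: eq_bigl => l; rewrite !inE.
Qed.

Lemma wedgeA : associative wedge.
Proof.
move=> u v w; apply/ffunP => I; rewrite !ffunE.
under [RHS]eq_bigr => K sKI do rewrite ffunE mulr_suml mulr_sumr.
rewrite (exchange_big_dep (fun J => J \subset I)) /=; last first.
  by move=> K J sKI sJK; apply: subset_trans sJK sKI.
apply: eq_bigr => J sJI; rewrite ffunE !mulr_sumr [RHS](reindex_onto (fun L : {set _} => J :|: L) (fun K : {set _} => K :\: J)) /=.
  apply: eq_big => [L|L sL].
    rewrite subUset subsetUl sJI andbT /= subsetD.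
    have [sLI /=|//] := boolP (L \subset I).
    apply/idP/eqP => [dLJ|<-]; first by rewrite setDUl setDv set0U; apply/setDidPl.
    by rewrite disjoints_subset subsetDr.
  move: sL; rewrite subsetD => /andP[sLI dLJ].
  have dJL : [disjoint J & L] by rewrite disjoint_sym.
  have -> : (J :|: L) :\: J = L.
    by rewrite setDUl setDv set0U; apply/setDidPl.
  have -> : I :\: (J :|: L) = (I :\: J) :\: L by rewrite setDDl.
  set M := (I :\: J) :\: L.
  have -> : I :\: J = L :|: M.
    by rewrite -[LHS](setID _ L) (setIidPr _) // subsetD sLI.
  have dLM : [disjoint L & M].
    by rewrite disjoint_sym disjoints_subset subsetDr.
  rewrite inversionsUr // inversionsUl // !exprD.
  rewrite [X in X * _ = _]mulrC -!mulrA; congr (_ * _).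
  by rewrite [u J * (_ * _)]mulrCA [LHS]mulrCA.
by move=> K /andP[_ sJK]; rewrite -[RHS](setID _ J) (setIidPr sJK).
Qed.

Lemma wedge1l : left_id ext1 wedge.
Proof.
move=> u; apply/ffunP => I; rewrite ffunE (bigD1 set0) ?sub0set //=.
rewrite big1 ?addr0 => [|J /andP[_ /negPf J0]]; last by rewrite ffunE J0 mul0r mulr0.
by rewrite /inversions big_set0 ffunE eqxx setD0 !mul1r.
Qed.

Lemma wedge1r : right_id ext1 wedge.
Proof.
move=> u; apply/ffunP => I; rewrite ffunE (bigD1 I) //= big1 ?addr0 => [|J].
  rewrite setDv ffunE eqxx mulr1 /inversions big1 ?mul1r // => i _.
  by rewrite big_set0.
move=> /andP[sJI nJI]; rewrite ffunE setD_eq0.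
have /negPf-> : ~~ (I \subset J) by apply: contra nJI => sIJ; rewrite eqEsubset sJI.
by rewrite !mulr0.
Qed.

HB.instance Definition _ := Monoid.isLaw.Build (ext F m) ext1 wedge wedgeA wedge1l wedge1r.

Lemma wedgeDl : left_distributive wedge +%R.
Proof.
move=> u v w; apply/ffunP => I; rewrite !ffunE -big_split.
by apply: eq_bigr => J _; rewrite ffunE mulrDl mulrDr.
Qed.

Lemma wedgeDr : right_distributive wedge +%R.
Proof.
move=> u v w; apply/ffunP => I; rewrite !ffunE -big_split.
by apply: eq_bigr => J _; rewrite ffunE !mulrDr.
Qed.

Lemma wedgeZl c u v : wedge (c *: u) v = c *: wedge u v.
Proof.
apply/ffunP => I; rewrite !ffunE [RHS]mulr_sumr; apply: eq_bigr => J _.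
by rewrite ffunE -[c *: u J]/(c * u J) -mulrA mulrCA.
Qed.

Lemma wedgeZr c u v : wedge u (c *: v) = c *: wedge u v.
Proof.
apply/ffunP => I; rewrite !ffunE [RHS]mulr_sumr; apply: eq_bigr => J _.
by rewrite ffunE -[c *: v _]/(c * v _) [u J * _]mulrCA [LHS]mulrCA.
Qed.

Lemma ext_vecE x I :
  ext_vec x I = if #|I| == 1%N then \sum_(i in I) x 0 i else 0.
Proof.
rewrite ffunE; case: ifPn => [/cards1P[i ->]|nI].
  by rewrite big_set1 (big_pred1 i) // => j; rewrite (inj_eq set1_inj) eq_sym.
by rewrite big1 // => i /eqP eI; rewrite eI cards1 in nI.
Qed.

Lemma wedge_vec_alt x : wedge (ext_vec x) (ext_vec x) = 0.
Proof.
apply/ffunP => I; rewrite !ffunE.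
have [/cards2P[i [k [nik ->]]]|nI] := boolP (#|I| == 2%N).
  wlog lik : i k nik / (i < k)%N => [IH|].
    case: (ltngtP i k) => [ltik|ltki|/val_inj/eqP]; first exact: IH.
      by rewrite setUC; apply: IH; rewrite // eq_sym.
    by rewrite (negPf nik).
  have nIi : [set i; k] :\: [set i] = [set k].
    by apply/setP=> j; rewrite !inE; case: (eqVneq j i) => [->|]//=; rewrite (negPf nik).
  have nIk : [set i; k] :\: [set k] = [set i].
    apply/setP=> j; rewrite !inE; case: (eqVneq j k) => [->|]//=; last by rewrite orbF.
    by rewrite eq_sym (negPf nik).
  rewrite (bigD1 [set i]) /=; last by rewrite sub1set !inE eqxx.
  rewrite (bigD1 [set k]) /=; last first.
    by rewrite sub1set !inE eqxx orbT (inj_eq set1_inj) eq_sym.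
  rewrite nIi nIk big1 => [|J /andP[/andP[sJ nJi] nJk]].
    rewrite /inversions !big_set1 lik ltnNge (ltnW lik) /= !ext_vecE !cards1 /= !big_set1.
    by rewrite expr0 expr1 mul1r mulN1r mulrC addr0 subrr.
  rewrite ext_vecE; case: ifP; rewrite ?mul0r ?mulr0 // => /cards1P[j eJ].
  by move: sJ nJi nJk; rewrite eJ sub1set !inE => /orP[]/eqP->; rewrite eqxx.
apply: big1 => J sJI; rewrite !ext_vecE; case: ifP => [J1|]; last by rewrite mul0r mulr0.
case: ifP => [I1|]; last by rewrite !mulr0.
by move: nI; rewrite -(cardsID J I) (setIidPr sJI) (eqP J1) (eqP I1).
Qed.
End Exterior.

Notation "u ∧ v" := (wedge u v) (at level 40, left associativity) : ring_scope.

Section CrossRatio.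
Variables (F : fieldType) (m : nat).
Implicit Types (A B S U W : {vspace 'rV[F]_m}) (a b : ext F m).

(* det W = Lambda^(dim W) W, as a line in the exterior algebra of F^m.        *)
Definition detv W : {vspace ext F m} :=
  <[\big[@wedge F m/ext1 F m]_(w <- vbasis W) ext_vec w]>%VS.

(* The quotient F^m / U, realised as the image of a linear map with kernel U. *)
(* This map restricts to the identity on its image, so that the elements of   *)
(* quotv U are vectors of F^m which lift themselves.                          *)
Definition quot_proj U : 'End('rV[F]_m) := \1%VF - projv U.
Definition quotv U : {vspace 'rV[F]_m} := limg (quot_proj U).

Lemma lker_quot_proj U : lker (quot_proj U) = U.
Proof.
apply/vspaceP => x; rewrite memv_ker add_lfunE opp_lfunE id_lfunE subr_eq0.
apply/eqP/idP => [->|/projv_id->//]; exact: memv_proj.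
Qed.

Lemma quot_proj_id U x : x \in quotv U -> quot_proj U x = x.
Proof.
case/memv_imgP => y _ ->; rewrite !(add_lfunE, opp_lfunE, id_lfunE).
by rewrite linearB /= projv_proj subrr subr0.
Qed.

(* The line det F^m is spanned by ext_top, and [ratio x y] is the x / y of    *)
(* two elements x, y of it.                                                   *)
Definition ratio (x y : ext F m) : F := (x setT : F) / (y setT : F).

Definition complementary_configuration k A1 A2 B1 B2 : Prop :=
  [/\ \dim A1 = k.+1, \dim A2 = k.+1,
      (\dim B1 + k.+1 = m)%N & (\dim B2 + k.+1 = m)%N] /\
  [/\ (A1 :&: B1)%VS = 0%VS, (A1 :&: B2)%VS = 0%VS,
      (A2 :&: B1)%VS = 0%VS & (A2 :&: B2)%VS = 0%VS].

Definition cross_ratio A1 A2 B1 B2 : F :=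
  let a1 := vpick (detv A1) in let a2 := vpick (detv A2) in
  let b1 := vpick (detv B1) in let b2 := vpick (detv B2) in
  ratio (a1 ∧ b1) (a1 ∧ b2) * ratio (a2 ∧ b2) (a2 ∧ b1).

Definition perturbation A B : Type :=
  'Hom(subvs_of (detv (A :&: B)), subvs_of (detv (quotv (A + B)))).

(* The image a /\ b' /\ phi(s) of a (x) b (x) phi in det F^m. Here B :\: A is *)
(* a complement of A :&: B in B, and b' is the multiple of a generator b0 of  *)
(* its determinant such that b = b' /\ s.                                     *)
Definition star A B a b (phi : perturbation A B) : ext F m :=
  let s := vpick (detv (A :&: B)) in
  let b0 := vpick (detv (B :\: A)) in
  let b' := coord [tuple b0 ∧ s] 0 b *: b0 in
  a ∧ b' ∧ vsval (phi (vsproj (detv (A :&: B)) s)).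

Definition deg_cross_ratio A1 A2 B1 B2
    (c11 : perturbation A1 B1) (c12 : perturbation A1 B2)
    (c21 : perturbation A2 B1) (c22 : perturbation A2 B2) : F :=
  let a1 := vpick (detv A1) in let a2 := vpick (detv A2) in
  let b1 := vpick (detv B1) in let b2 := vpick (detv B2) in
  ratio (star a1 b1 c11) (star a1 b2 c12) *
  ratio (star a2 b2 c22) (star a2 b1 c21).

Lemma ratioZ (c d : F) (x y : ext F m) : ratio (c *: x) (d *: y) = c / d * ratio x y.
Proof. by rewrite /ratio !ffunE mulf_div. Qed.

Lemma starZ A B a b (phi : perturbation A B) (c d : F) :
  star (c *: a) (d *: b) phi = (c * d) *: star a b phi.
Proof. by rewrite /star linearZ /= !(wedgeZl, wedgeZr) !scalerA mulrA. Qed.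

Lemma detv_generatorP W a : a \in detv W -> a != 0 ->
  exists2 c, c != 0 & vpick (detv W) = c *: a.
Proof.
have /vlineP[d Ed] := memv_pick (detv W); rewrite Ed.
case/vlineP => c -> /[!scaler_eq0] /norP[c0 w0].
exists (d / c); last by rewrite scalerA divfK.
rewrite mulf_neq0 ?invr_eq0 //; apply: contraNneq w0 => d0.
have /eqP d_W : detv W == 0%VS by rewrite -vpick0 Ed d0 scale0r.
by rewrite -memv0 -d_W memv_line.
Qed.

Lemma cross_ratioE A1 A2 B1 B2 a1 a2 b1 b2 :
  a1 \in detv A1 -> a2 \in detv A2 -> b1 \in detv B1 -> b2 \in detv B2 ->
  a1 != 0 -> a2 != 0 -> b1 != 0 -> b2 != 0 ->
  cross_ratio A1 A2 B1 B2 = ratio (a1 ∧ b1) (a1 ∧ b2) * ratio (a2 ∧ b2) (a2 ∧ b1).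
Proof.
rewrite /cross_ratio => Ha1 Ha2 Hb1 Hb2 na1 na2 nb1 nb2.
have [x1 nx1 ->] := detv_generatorP Ha1 na1; have [x2 nx2 ->] := detv_generatorP Ha2 na2.
have [y1 ny1 ->] := detv_generatorP Hb1 nb1; have [y2 ny2 ->] := detv_generatorP Hb2 nb2.
rewrite !(wedgeZl, wedgeZr, scalerA) !ratioZ mulrACA -[RHS]mul1r; congr (_ * _).
rewrite -!mulf_div !divff // !mul1r mulf_div [y2 * y1]mulrC divff //.
by rewrite mulf_neq0.
Qed.

Lemma deg_cross_ratioE A1 A2 B1 B2 (c11 : perturbation A1 B1) (c12 : perturbation A1 B2)
    (c21 : perturbation A2 B1) (c22 : perturbation A2 B2) a1 a2 b1 b2 :
  a1 \in detv A1 -> a2 \in detv A2 -> b1 \in detv B1 -> b2 \in detv B2 ->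
  a1 != 0 -> a2 != 0 -> b1 != 0 -> b2 != 0 ->
  deg_cross_ratio c11 c12 c21 c22 =
    ratio (star a1 b1 c11) (star a1 b2 c12) * ratio (star a2 b2 c22) (star a2 b1 c21).
Proof.
rewrite /deg_cross_ratio => Ha1 Ha2 Hb1 Hb2 na1 na2 nb1 nb2.
have [x1 nx1 ->] := detv_generatorP Ha1 na1; have [x2 nx2 ->] := detv_generatorP Ha2 na2.
have [y1 ny1 ->] := detv_generatorP Hb1 nb1; have [y2 ny2 ->] := detv_generatorP Hb2 nb2.
rewrite !starZ !ratioZ mulrACA -[RHS]mul1r; congr (_ * _).
rewrite -!mulf_div !divff // !mul1r mulf_div [y2 * y1]mulrC divff //.
by rewrite mulf_neq0.
Qed.

End CrossRatio.

Arguments deg_cross_ratio {F m} A1 A2 B1 B2 c11 c12 c21 c22.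

Record discrete_valuation (K : fieldType) := DiscreteValuation {
  dval :> K -> int;
  dvalM : forall x y, x != 0 -> y != 0 -> dval (x * y) = dval x + dval y;
  dvalD : forall x y, x != 0 -> y != 0 -> x + y != 0 ->
    Num.min (dval x) (dval y) <= dval (x + y);
  dval_surj : forall z, exists2 x, x != 0 & dval x = z
}.

(* The value of a valuation at 0 is unconstrained.                            *)
Definition is_valuation_ring (R : idomainType)
    (v : discrete_valuation {fraction R}) : Prop :=
  forall x : {fraction R},
    (exists r : R, x = tofrac r) <-> (x = 0 \/ 0 <= v x).

Definition is_uniformiser (R : idomainType)
    (v : discrete_valuation {fraction R}) (t : R) : Prop :=
  t != 0 /\ v (tofrac t) = 1.

(* [res] exhibits kappa as R / m, the maximal ideal m of a local ring being   *)
(* the set of its non-units.                                                  *)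
Definition is_residue_map (R : idomainType) (kappa : fieldType)
    (res : {rmorphism R -> kappa}) : Prop :=
  (forall y, exists r, res r = y) /\
  (forall r, res r = 0 <-> r \isn't a GRing.unit).

Section Limit.
Variables (R : idomainType) (kappa : fieldType).
Variables (v : discrete_valuation {fraction R}).
Variables (res : {rmorphism R -> kappa}) (t : R) (m : nat).
Implicit Types (A B : {vspace 'rV[{fraction R}]_m}).

(* Meaningful only for x integral, that is, in the image of R.                *)
Definition reduction (x : {fraction R}) : kappa :=
  res (epsilon (inhabits 0) (fun r : R => tofrac r = x)).

Definition regt (x : {fraction R}) : kappa :=
  reduction (tofrac t ^ (- v x) * x).

(* The homogeneous equations over R of the Zariski closure of P(A) in P^(m-1) *)
(* over R.                                                                    *)
Definition closure_equation A (f : {mpoly R[m]}) : Prop :=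
  (exists d, f \is d.-homog) /\
  (forall x, x \in A -> (map_mpoly (@tofrac R) f).@[fun i => x 0 i] = 0).

Definition is_special_fibre A (W : {vspace 'rV[kappa]_m}) : Prop :=
  forall y, y \in W <->
    (forall f, closure_equation A f -> (map_mpoly res f).@[fun i => y 0 i] = 0).

Definition special_fibre A : {vspace 'rV[kappa]_m} :=
  epsilon (inhabits 0%VS) (is_special_fibre A).

Definition lattice A : {pred 'rV[R]_m} :=
  [pred x | map_mx (@tofrac R) x \in A].

Definition lattice_basis A (X : 'M[R]_(\dim A, m)) : Prop :=
  (forall i, row i X \in lattice A) /\
  (forall x, x \in lattice A -> exists! u : 'rV[R]_(\dim A), x = u *m X).

(* The matrix (of size 1) of det Psi in the R-bases of the determinants       *)
(* given by the rows of X, the rows of Y and the standard basis of R^m.       *)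
Definition det_psi p q (X : 'M[R]_(p, m)) (Y : 'M[R]_(q, m)) : R :=
  (wedge_rows X ∧ wedge_rows Y) setT.

(* reg_t (det Psi) is determined by its value on the generator of             *)
(* det A^s (x) det B^s obtained by reducing R-bases of the lattices.          *)
Definition is_limit_perturbation A B
    (c : perturbation (special_fibre A) (special_fibre B)) : Prop :=
  c != 0 /\
  forall X Y, lattice_basis (A := A) X -> lattice_basis (A := B) Y ->
    star (wedge_rows (map_mx res X)) (wedge_rows (map_mx res Y)) c =
      regt (tofrac (det_psi X Y)) *: ext_top kappa m.

Definition limit_perturbation A B :
    perturbation (special_fibre A) (special_fibre B) :=
  epsilon (inhabits 0) (@is_limit_perturbation A B).

End Limit.

(* Main.v *)
(* Take R-bases of the four lattices in echelon form, that is, with the        *)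
(* identity as a submatrix; they stay independent modulo m, and the special    *)
(* fibre of each closure is the row space of the reduced matrix, being cut out *)
(* by the reductions of the linear equations x_j = sum_i X_ij x_(f i). With    *)
(* the wedges of these bases as generators, the cross-ratio over K is the      *)
(* quotient of the determinants det Psi_ij, and by definition of the limit     *)
(* perturbation the degenerate one is the same quotient of their regularised   *)
(* values, so that the theorem is the multiplicativity of reg_t. The limit     *)
(* perturbation exists because a /\ b' /\ phi(s) takes every value in det V as *)
(* phi varies, and because changing the lattice bases multiplies both sides of *)
(* its defining equation by the same unit.                                     *)

Require Import Defs.
From mathcomp Require Import all_boot all_order all_algebra.
From mathcomp Require Import zify ring.
From Stdlib Require Import ClassicalEpsilon.
Import Order.TTheory GRing.Theory Num.Theory.
Local Open Scope ring_scope.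

Set Implicit Arguments.
Unset Strict Implicit.
Unset Printing Implicit Defensive.

(** A cross-ratio may be computed from any generators of the determinant lines ([cross_ratioE],
    [deg_cross_ratioE]), so a single integral matrix per subspace serves both sides.
    [exists_echelon_basis] gives a matrix over R with an identity block whose rows span the subspace
    over K. The block reads off coordinates, so the rows form a basis of the lattice
    ([echelon_basis_lattice]); it survives reduction, so the reduced rows form a basis of the
    special fibre ([special_fibre_echelon], [echelon_basis_special]).

    With these generators the cross-ratio over K is d11/d12 times d22/d21, where d_ij is the value
    of [det_psi], and [limit_perturbationP] turns the degenerate cross-ratio into the same
    expression in the reg_t d_ij. The two agree because reg_t is multiplicative ([regtM],
    [regt_div]). Complementarity makes each d_ij nonzero ([det_psi_neq0]), whence the value is a
    unit.

    The limit perturbation exists by [exists_star]. That its defining equation holds for all lattice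
    bases at once rests on [wedge_rows_mulmx], that is, on the coordinates of a wedge being maximal
    minors. *)

(** * Coordinates of wedges as minors *)

Section Pull.
Context {F : comNzRingType}.

Lemma ltn_mono_inj (q m : nat) (f : 'I_q -> 'I_m) :
  {mono f : i j / (i < j)%N} -> injective f.
Proof.
move=> fm i j eq_ij; apply: val_inj; have := fm i j; have := fm j i.
by rewrite eq_ij ltnn; case: ltngtP.
Qed.

(** For increasing [f] this is the map of exterior algebras induced by the coordinate projection
    [colsub f]; monotonicity is what avoids signs. *)
Definition face_pull (q m : nat) (f : 'I_q -> 'I_m) (u : ext F m) : ext F q :=
  [ffun I : {set 'I_q} => u (f @: I)].

Lemma inversions_imset (q m : nat) (f : 'I_q -> 'I_m) (J L : {set 'I_q}) :
  {mono f : i j / (i < j)%N} -> inversions (f @: J) (f @: L) = inversions J L.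
Proof.
move=> fm.
have fi := ltn_mono_inj fm.
rewrite /inversions big_imset /=; last by move=> ? ? _ _; apply: fi.
apply: eq_bigr => j _; rewrite big_imset /=; last by move=> ? ? _ _; apply: fi.
by apply: eq_bigr => l _; rewrite fm.
Qed.

Lemma face_pull_wedge (q m : nat) (f : 'I_q -> 'I_m) (u w : ext F m) :
  {mono f : i j / (i < j)%N} -> face_pull f (u ∧ w) = face_pull f u ∧ face_pull f w.
Proof.
move=> fm.
have fi := ltn_mono_inj fm.
apply/ffunP => I; rewrite !ffunE.
rewrite (reindex_onto (fun J : {set 'I_q} => f @: J) (fun J => f @^-1: J)) /=; last first.
  move=> J sJ; apply/setP => x; apply/imsetP/idP => [[y]|xJ]; first by rewrite inE => ? ->.
  by have /imsetP[y _ ex] := subsetP sJ x xJ; exists y; rewrite // inE -ex.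
have fK (J : {set 'I_q}) : f @^-1: (f @: J) = J.
  by apply/setP => x; rewrite inE mem_imset.
have fD (J : {set 'I_q}) : f @: I :\: f @: J = f @: (I :\: J).
  apply/setP => x; apply/setDP/imsetP => [[/imsetP[y yI ->]]|[y /setDP[yI yJ] ->]].
    by rewrite mem_imset // => yJ; exists y; rewrite // inE yJ.
  by rewrite !mem_imset.
apply: eq_big => [J|J _]; last by rewrite !ffunE fD inversions_imset.
rewrite fK eqxx andbT; apply/idP/idP => [sJI|]; last exact: imsetS.
by apply/subsetP => x /(imset_f f)/(subsetP sJI); rewrite mem_imset.
Qed.

Lemma wedge_rows_imset (p q m : nat) (f : 'I_q -> 'I_m) (X : 'M[F]_(p, m))
    (I : {set 'I_q}) :
  {mono f : i j / (i < j)%N} ->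
  wedge_rows X (f @: I) = wedge_rows (colsub f X) I.
Proof.
move=> fm.
have fi := ltn_mono_inj fm.
suff <-: face_pull f (wedge_rows X) = wedge_rows (colsub f X) by rewrite ffunE.
rewrite /wedge_rows (big_morph (face_pull f) (id1 := ext1 F q) (op1 := @wedge F q)).
- apply: eq_bigr => i _; apply/ffunP => J; rewrite ffunE !ext_vecE.
  rewrite card_imset //; case: ifP => // _.
  rewrite big_imset /=; last by move=> ? ? _ _; apply: fi.
  by apply: eq_bigr => j _; rewrite !mxE.
- by move=> u w; apply: face_pull_wedge.
- by apply/ffunP => J; rewrite !ffunE imset_eq0.
Qed.

Lemma inversions_set1_setC1 (m : nat) (j : 'I_m) : inversions [set j] [set~ j] = j.
Proof.
rewrite /inversions big_set1 big_mkcond /=.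
rewrite (eq_bigr (fun l : 'I_m => if (l < j)%N then 1%N else 0%N)); last first.
  by move=> l _; rewrite !inE; case: eqVneq => [->|_]; rewrite ?ltnn //; case: (l < j)%N.
by rewrite -big_mkcond /= (big_ord_narrow (ltnW (ltn_ord j))) sum1_card card_ord.
Qed.

(** Moving e_j past the j smaller basis vectors costs (-1)^j: this is Laplace expansion along the
    first row. *)
Lemma ext_vec_wedge_setT (m : nat) (x : 'rV[F]_m) (u : ext F m) :
  (ext_vec x ∧ u) setT = \sum_j x 0 j * ((-1) ^+ j * (u [set~ j] : F)).
Proof.
rewrite ffunE; under eq_bigr => J _ do rewrite ffunE mulr_suml mulr_sumr.
rewrite (exchange_big_dep predT) //=; apply: eq_bigr => j _.
rewrite (big_pred1 [set j]) => [|J]; last by rewrite subsetT.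
by rewrite setTD inversions_set1_setC1 mulrCA.
Qed.

Lemma wedge_rows_setT n (X : 'M[F]_n) : wedge_rows X setT = \det X.
Proof.
elim: n X => [|n IHn] X.
  rewrite /wedge_rows big_ord0 det_mx00 ffunE.
  by case: eqP => // /setP[]; move=> [].
rewrite (expand_det_row _ ord0) /wedge_rows big_ord_recl /= ext_vec_wedge_setT.
apply: eq_bigr => j _; congr (_ * _); first by rewrite mxE.
rewrite /cofactor add0n -IHn; congr (_ * _).
(* [lift j] is the increasing map that skips j, so pulling back along it deletes column j. *)
have -> : [set~ j] = lift j @: [set: 'I_n].
  apply/setP => i; rewrite !inE; apply/idP/imsetP => [|[k _ ->]]; last first.
    by rewrite eq_sym neq_lift.
  by case: (unliftP j i) => [k -> _|->]; [exists k | rewrite eqxx].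
transitivity (wedge_rows (rowsub (lift ord0) X) (lift j @: [set: 'I_n])).
  congr (fun_of_fin _ _); apply: eq_bigr => i _; congr ext_vec.
  by apply/rowP => l; rewrite !mxE.
rewrite wedge_rows_imset; last by move=> i k; rewrite /= /bump; lia.
by congr (fun_of_fin (wedge_rows _) _); apply/matrixP => i k; rewrite !mxE.
Qed.

(** The enumeration of [I] is a filter of the sorted list of all indices. Hence [wedge_rows_imset]
    applies to it and yields [wedge_rows_minor]. *)
Lemma ltn_enum_val (m : nat) (I : {set 'I_m}) :
  {mono @enum_val _ (mem I) : i j / (i < j)%N}.
Proof.
have homo_I : {homo @enum_val _ (mem I) : i j / (i < j)%N}.
  move=> i j lij; pose x0 := enum_val i; rewrite (enum_val_nth x0 i) (enum_val_nth x0 j).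
  have tr : transitive (relpre (val : 'I_m -> nat) ltn) by move=> ? ? ?; apply: ltn_trans.
  apply: (sorted_ltn_nth tr) => //; rewrite ?inE -?cardE //.
  rewrite sorted_filter // -enumT -sorted_map val_enum_ord.
  exact: iota_ltn_sorted.
move=> i j; case: (ltngtP i j) => [/homo_I//|/homo_I|/val_inj->]; last by rewrite ltnn.
by case: ltngtP.
Qed.

Definition wedge_seq (m : nat) (s : seq 'rV[F]_m) : ext F m :=
  \big[@wedge F m/ext1 F m]_(w <- s) ext_vec w.

Lemma wedge_seq_cat (m : nat) (s1 s2 : seq 'rV[F]_m) :
  wedge_seq (s1 ++ s2) = wedge_seq s1 ∧ wedge_seq s2.
Proof. exact: big_cat. Qed.

Lemma wedge_rows_seq (p m : nat) (X : 'M[F]_(p, m)) :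
  wedge_rows X = wedge_seq [seq row i X | i <- enum 'I_p].
Proof. by rewrite /wedge_seq /wedge_rows big_map enumT [index_enum _]unlock. Qed.

Lemma wedge_seq_rows (p m : nat) (s : p.-tuple 'rV[F]_m) :
  wedge_seq s = wedge_rows (\matrix_i tnth s i).
Proof.
by rewrite /wedge_seq big_tuple; apply: eq_bigr => i _; rewrite rowK.
Qed.

Lemma wedge_seq_homog (m : nat) (s : seq 'rV[F]_m) (I : {set 'I_m}) :
  #|I| != size s -> wedge_seq s I = 0.
Proof.
rewrite /wedge_seq; elim: s I => [|x s IHs] I /= nI.
  by rewrite big_nil ffunE -cards_eq0 (negPf nI).
rewrite big_cons ffunE big1 // => J sJI; rewrite ext_vecE.
case: ifP => [J1|_]; last by rewrite mul0r mulr0.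
rewrite IHs ?mulr0 //; apply: contra nI.
by rewrite -(cardsID J I) (setIidPr sJI) (eqP J1) add1n eqSS.
Qed.

Lemma wedge_seq_ext_top (m : nat) (s : seq 'rV[F]_m) :
  size s = m -> wedge_seq s = (wedge_seq s setT : F) *: ext_top F m.
Proof.
move=> sz; apply/ffunP => I; rewrite !ffunE.
have [->|nI] := eqVneq I setT; first exact/esym/mulr1.
rewrite (wedge_seq_homog (I := I)); first by rewrite mulr0n scaler0.
by apply: contra nI; rewrite sz => /eqP cI; rewrite eqEcard subsetT cardsT card_ord cI /=.
Qed.

Lemma wedge_rows_minor (m : nat) (I : {set 'I_m}) (X : 'M[F]_(#|I|, m)) :
  wedge_rows X I = \det (colsub (@enum_val _ (mem I)) X).
Proof.
transitivity (wedge_rows X (@enum_val _ (mem I) @: setT)).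
  congr (fun_of_fin _ _); apply/setP => x; apply/idP/imsetP => [xI|[i _ ->]].
    by exists (enum_rank_in xI x); rewrite ?enum_rankK_in.
  exact: enum_valP.
by rewrite wedge_rows_imset ?wedge_rows_setT //; exact: ltn_enum_val.
Qed.

(** Coordinates in degree p are maximal minors and scale by the determinant of [g]; all others
    vanish on both sides. *)
Lemma wedge_rows_mulmx (p m : nat) (g : 'M[F]_p) (X : 'M[F]_(p, m)) :
  wedge_rows (g *m X) = \det g *: wedge_rows X.
Proof.
apply/ffunP => I; rewrite ffunE.
have [eI|nI] := eqVneq #|I| p; last first.
  have sz Y : size [seq row i (Y : 'M[F]_(p, m)) | i <- enum 'I_p] = p.
    by rewrite size_map size_enum_ord.
  rewrite !wedge_rows_seq !(wedge_seq_homog (I := I)) ?sz //.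
  exact/esym/mulr0.
move: g X; case: _ / eI => g X.
by rewrite !wedge_rows_minor -mulmx_colsub det_mulmx.
Qed.

Lemma wedge_rows1 (m : nat) : wedge_rows (1%:M : 'M[F]_m) = ext_top F m.
Proof.
rewrite wedge_rows_seq wedge_seq_ext_top; last by rewrite size_map size_enum_ord.
by rewrite -wedge_rows_seq wedge_rows_setT det1 scale1r.
Qed.

End Pull.

(** * Determinant lines and bases *)

Section Basis.
Context {F : fieldType} {m : nat}.
Implicit Types (U W A B : {vspace 'rV[F]_m}) (s : seq 'rV[F]_m).

Lemma vlineZ (V : vectType F) (c : F) (x : V) : c != 0 -> (<[c *: x]> = <[x]>)%VS.
Proof.
move=> c0; apply/vspaceP => y; apply/vlineP/vlineP => -[d ->].
  by exists (d * c); rewrite scalerA.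
by exists (d / c); rewrite scalerA divfK.
Qed.

Lemma detvE W : detv W = <[wedge_seq (vbasis W)]>%VS.
Proof. by []. Qed.

(** The constant is the determinant of the matrix expressing [s2] in the basis [s1]. *)
Lemma basis_of_wedge_seq W s1 s2 :
  basis_of W s1 -> {subset s2 <= W} -> size s2 = size s1 ->
  exists c, wedge_seq s2 = c *: wedge_seq s1.
Proof.
move=> b1 s2W sz.
have W1 : W = <<in_tuple s1>>%VS by rewrite (span_basis b1).
pose t2 := tcast sz (in_tuple s2).
pose g := \matrix_(i < size s1, j < size s1) coord (in_tuple s1) j (tnth t2 i).
exists (\det g).
have -> : wedge_seq s2 = wedge_seq t2 by rewrite val_tcast.
rewrite -[s1]/(tval (in_tuple s1)) !wedge_seq_rows -wedge_rows_mulmx.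
congr wedge_rows; apply/row_matrixP => i; rewrite row_mul rowK.
rewrite [LHS](@coord_span _ _ _ (in_tuple s1)) -?W1.
  rewrite mulmx_sum_row; apply: eq_bigr => j _.
  by rewrite rowK 2!mxE [tnth _ j](tnth_nth 0).
have : tnth t2 i \in t2 by apply: mem_tnth.
by rewrite memtE val_tcast => /s2W.
Qed.

Lemma dim_fullv : \dim (fullv : {vspace 'rV[F]_m}) = m.
Proof. by rewrite dimvf dim_matrix; apply: mul1n. Qed.

Lemma wedge_seq_full_neq0 s : basis_of fullv s -> wedge_seq s setT != 0.
Proof.
move=> bs.
have sz : size s = m by rewrite -(size_basis (X := in_tuple s) bs) dim_fullv.
have [c] : exists c, ext_top F m = c *: wedge_seq s.
  rewrite -wedge_rows1 wedge_rows_seq; apply: basis_of_wedge_seq bs _ _.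
    by move=> x _; apply: memvf.
  by rewrite size_map size_enum_ord.
move/ffunP/(_ setT); rewrite !ffunE eqxx => e1; apply/eqP => s0.
by move/eqP: e1; rewrite s0 [_ *: _]mulr0 oner_eq0.
Qed.

(** Completing [s] to a basis of the whole space gives a nonzero top wedge that has the wedge of [s]
    as a factor. *)
Lemma wedge_seq_basis_neq0 W s : basis_of W s -> wedge_seq s != 0.
Proof.
move=> bs.
have b : basis_of fullv (vbasis (fullv :\: W) ++ s).
  have e : (fullv :\: W + W)%VS = fullv :> {vspace 'rV[F]_m}.
    by rewrite addv_diff; apply/eqP; rewrite eqEsubv subvf addvSl.
  rewrite -[X in basis_of X]e; apply: cat_basis (vbasisP _) bs.
  by apply/directv_addP; rewrite capv_diff.
apply: contraNneq (wedge_seq_full_neq0 b) => s0.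
by rewrite wedge_seq_cat s0 ffunE big1 // => J _; rewrite ffunE !mulr0.
Qed.

Lemma detv_basis W s : basis_of W s -> detv W = <[wedge_seq s]>%VS.
Proof.
move=> bs; rewrite detvE; have bW := vbasisP W.
have [c e] : exists c, wedge_seq s = c *: wedge_seq (vbasis W).
  apply: (basis_of_wedge_seq bW) => [x|]; first exact: (basis_mem bs).
  by rewrite size_tuple (size_basis (X := in_tuple s) bs).
have s0 := wedge_seq_basis_neq0 bs.
rewrite e in s0 *; rewrite vlineZ //.
by apply: contraNneq s0 => ->; rewrite scale0r.
Qed.

End Basis.

(** * The isomorphism onto det V *)

Section Star.
Context {F : fieldType} {m : nat}.
Implicit Types (U W A B : {vspace 'rV[F]_m}) (a b : ext F m).

Lemma wedge_seq_full (s : seq 'rV[F]_m) :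
  basis_of fullv s -> exists2 c : F, c != 0 & wedge_seq s = c *: ext_top F m.
Proof.
move=> bs; exists (wedge_seq s setT); first exact: wedge_seq_full_neq0.
apply: wedge_seq_ext_top.
by rewrite -(size_basis (X := in_tuple s) bs) dim_fullv.
Qed.

Lemma vpick_detv W : exists2 c, c != 0 & vpick (detv W) = c *: wedge_seq (vbasis W).
Proof.
apply: detv_generatorP; first by rewrite detvE memv_line.
exact: (wedge_seq_basis_neq0 (vbasisP W)).
Qed.

(** With [capv_quotv]: the model [quotv U] of the quotient is a complement of U. *)
Lemma addv_quotv U : (U + quotv U)%VS = fullv.
Proof.
apply/eqP; rewrite eqEsubv subvf; apply/subvP => x _.
rewrite -[x](subrK (quot_proj U x)) addrC addrC memv_add //; last first.
  by rewrite memv_img ?memvf.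
by rewrite add_lfunE opp_lfunE id_lfunE opprB addrCA subrr addr0 memv_proj.
Qed.

Lemma capv_quotv U : (U :&: quotv U)%VS = 0%VS.
Proof.
apply/eqP; rewrite -subv0; apply/subvP => x; rewrite memv_cap => /andP[xU /quot_proj_id <-].
by rewrite memv0 -memv_ker lker_quot_proj.
Qed.

Lemma basis_of_diff_cap A B :
  basis_of B (vbasis (B :\: A) ++ vbasis (A :&: B)).
Proof.
rewrite capvC -[X in basis_of X](addv_diff_cap B A).
apply: cat_basis (vbasisP _) (vbasisP _).
apply/directv_addP/eqP; rewrite -subv0 -(capv_diff B A).
by rewrite capvS // capvSr.
Qed.

Lemma basis_of_star A B :
  basis_of fullv ((vbasis A ++ vbasis (B :\: A)) ++ vbasis (quotv (A + B))).
Proof.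
rewrite -(addv_quotv (A + B)); apply: cat_basis (vbasisP _).
  by apply/directv_addP; exact: capv_quotv.
rewrite addvC -addv_diff addvC; apply: cat_basis (vbasisP _) (vbasisP _).
by apply/directv_addP; rewrite capvC capv_diff.
Qed.

(** The perturbations form a line on which [star] is linear, and it is nonzero there because A, a
    complement of the intersection in B, and Q together span the space directly. *)
Lemma exists_star A B a b (x : F) :
  a \in detv A -> b \in detv B -> a != 0 -> b != 0 ->
  exists phi : perturbation A B, star a b phi = x *: ext_top F m.
Proof.
move=> aA bB a0 b0.
have [cs cs0 Es] := vpick_detv (A :&: B); have [cb cb0 Eb] := vpick_detv (B :\: A).
have dB : detv B = <[vpick (detv (B :\: A)) ∧ vpick (detv (A :&: B))]>%VS.
  rewrite (detv_basis (basis_of_diff_cap A B)) wedge_seq_cat Es Eb.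
  by rewrite wedgeZl wedgeZr !vlineZ.
have [ca Ea] : exists ca, a = ca *: wedge_seq (vbasis A) by apply/vlineP.
set y := _ ∧ _ in dB.
have Ey : b = coord [tuple y] 0 b *: y.
  by rewrite {1}(@coord_span _ _ _ [tuple y] b) ?big_ord1 // span_seq1 -dB.
pose q := wedge_seq (vbasis (quotv (A + B))).
(* This is the value of [star] at the perturbation sending the generator of det S to [q]; rescaling
   it by x / g reaches the required value. *)
pose z := a ∧ (coord [tuple y] 0 b *: vpick (detv (B :\: A))) ∧ q.
have [g g0 Ez] : exists2 g : F, g != 0 & z = g *: ext_top F m.
  have [d d0 Ed] := wedge_seq_full (basis_of_star A B).
  have ca0 : ca != 0 by apply: contraNneq a0 => ca0; rewrite Ea ca0 scale0r.
  have cy0 : coord [tuple y] 0 b != 0.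
    by apply: contraNneq b0 => c0; rewrite Ey c0 scale0r.
  exists (ca * (coord [tuple y] 0 b * cb) * d); first by rewrite !mulf_neq0.
  rewrite /z {1}Ea Eb !(wedgeZl, wedgeZr) !scalerA -!wedge_seq_cat Ed scalerA.
  by congr (_ *: _); ring.
pose s := vsproj (detv (A :&: B)) (vpick (detv (A :&: B))).
have s0 : free [:: s].
  rewrite seq1_free; apply: contraNneq (wedge_seq_basis_neq0 (vbasisP (A :&: B))) => s0.
  have := vsprojK (memv_pick (detv (A :&: B))); rewrite -/s s0 Es linear0.
  by move/esym/eqP; rewrite scaler_eq0 (negPf cs0).
have qQ : q \in detv (quotv (A + B)) by rewrite detvE memv_line.
have [f Hf] := linear_of_free [:: s] [:: vsproj (detv (quotv (A + B))) (x / g *: q)].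
have [fs] := Hf s0 erefl.
exists (linfun f).
rewrite /star -/s lfunE /= fs vsprojK ?memvZ //.
by rewrite wedgeZr -/y -/z Ez scalerA divfK.
Qed.

End Star.

(** * Valuations of inverses and powers *)

Section Valuation.
Context {K : fieldType} (v : discrete_valuation K).

Lemma dval1 : v 1 = 0.
Proof. by apply: (addrI (v 1)); rewrite -dvalM ?oner_eq0 // mulr1 addr0. Qed.

Lemma dvalV x : x != 0 -> v x^-1 = - v x.
Proof.
move=> x0; apply: (addIr (v x)).
by rewrite -dvalM ?invr_eq0 // mulVf // dval1 addNr.
Qed.

Lemma dvalX x (n : nat) : x != 0 -> v (x ^+ n) = v x *+ n.
Proof.
move=> x0; elim: n => [|n IHn]; first by rewrite dval1.
by rewrite exprS dvalM ?expf_neq0 // IHn mulrS.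
Qed.

Lemma dvalXz x (z : int) : x != 0 -> v (x ^ z) = v x * z.
Proof.
move=> x0; case: z => n; first by rewrite -exprnP dvalX // -mulr_natr natz.
by rewrite NegzE -exprnN dvalV ?expf_neq0 // dvalX // mulrN -mulr_natr natz.
Qed.

End Valuation.

(** * Units, residues and reg_t *)

Section Reduction.
Context {R : idomainType} {kappa : fieldType}.
Context {v : discrete_valuation {fraction R}} {res : {rmorphism R -> kappa}} {t : R}.
Context (hR : is_valuation_ring v) (hres : is_residue_map res) (ht : is_uniformiser v t).

Local Notation frac := (@tofrac R).

Lemma dval_integral x : 0 <= v x -> exists r, x = frac r.
Proof. by move=> vx; apply/hR; right. Qed.

Lemma dval_tofrac_ge0 r : r != 0 -> 0 <= v (frac r).
Proof.
move=> r0; have [] : frac r = 0 \/ 0 <= v (frac r) by apply/hR; exists r.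
  by move/eqP; rewrite tofrac_eq0 (negPf r0).
by [].
Qed.

Lemma tofrac_inj : injective frac.
Proof. by move=> x y /eqP; rewrite tofrac_eq => /eqP. Qed.

Lemma dval_unit r : r \is a GRing.unit -> v (frac r) = 0.
Proof.
move=> ur; have r0 : r != 0 by apply: contraTneq ur => ->; rewrite unitr0.
apply/eqP; rewrite eq_le dval_tofrac_ge0 // andbT.
rewrite -oppr_ge0 -dvalV ?tofrac_eq0 //.
have -> : (frac r)^-1 = frac r^-1.
  have f0 : frac r != 0 by rewrite tofrac_eq0.
  by apply: (mulfI f0); rewrite mulfV // -tofracM divrr // tofrac1.
by rewrite dval_tofrac_ge0 // invr_eq0.
Qed.

Lemma dval_eq0_unit x : x != 0 -> v x = 0 -> exists2 r, r \is a GRing.unit & x = frac r.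
Proof.
move=> x0 vx; have [r Er] : exists r, x = frac r by apply: dval_integral; rewrite vx.
have [s Es] : exists s, x^-1 = frac s by apply: dval_integral; rewrite dvalV // vx oppr0.
exists r => //; apply/unitrP; exists s.
have rs : r * s = 1 by apply: tofrac_inj; rewrite tofracM -Er -Es mulfV // tofrac1.
by rewrite mulrC.
Qed.

(** The choice made in [reduction] is forced, since R embeds in its fraction field. *)
Lemma reduction_tofrac r : reduction res (frac r) = res r.
Proof.
rewrite /reduction; congr (res _); apply: tofrac_inj.
by apply: (epsilon_spec (inhabits 0) (fun s => frac s = frac r)); exists r.
Qed.

Lemma residue_eq0 r : (res r == 0) = (r \isn't a GRing.unit).
Proof. by apply/eqP/idP => /(proj2 hres r). Qed.

(** Dividing x by t to the power v(x) leaves an element of valuation 0, hence a unit of R. *)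
Lemma regtP x : x != 0 ->
  exists2 r, r \is a GRing.unit & frac t ^ (- v x) * x = frac r /\ regt v res t x = res r.
Proof.
case: ht => t0 vt x0; have ft0 : frac t != 0 by rewrite tofrac_eq0.
have [||r ur Er] := @dval_eq0_unit (frac t ^ (- v x) * x).
- by rewrite mulf_neq0 // expfz_neq0.
- by rewrite dvalM ?expfz_neq0 // dvalXz // vt mul1r addNr.
by exists r => //; split; rewrite // /regt Er reduction_tofrac.
Qed.

Lemma regt_neq0 x : x != 0 -> regt v res t x != 0.
Proof. by move=> /regtP[r ur [_ ->]]; rewrite residue_eq0 negbK. Qed.

Lemma regtM x y : x != 0 -> y != 0 ->
  regt v res t (x * y) = regt v res t x * regt v res t y.
Proof.
move=> x0 y0; have ft0 : frac t != 0 by case: ht => t0 _; rewrite tofrac_eq0.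
have [r _ [Er ->]] := regtP x0; have [s _ [Es ->]] := regtP y0.
rewrite -rmorphM -reduction_tofrac tofracM -Er -Es /regt dvalM // opprD expfzDr //.
by rewrite mulrACA.
Qed.

Lemma regt_unit r : r \is a GRing.unit -> regt v res t (frac r) = res r.
Proof. by move=> ur; rewrite /regt dval_unit // oppr0 expr0z mul1r reduction_tofrac. Qed.

Lemma regt_div x y : x != 0 -> y != 0 ->
  regt v res t (x / y) = regt v res t x / regt v res t y.
Proof.
move=> x0 y0; apply: (mulIf (regt_neq0 y0)).
by rewrite -regtM ?mulf_neq0 ?invr_eq0 // !divfK ?regt_neq0.
Qed.

End Reduction.

(** * Row spaces and selected columns *)

Section Rows.
Context {F : fieldType} {p m : nat}.

Lemma mem_span_rows (T : p.-tuple 'rV[F]_m) (w : 'rV[F]_m) :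
  reflect (exists u : 'rV_p, w = u *m \matrix_i tnth T i) (w \in <<T>>%VS).
Proof.
apply: (iffP idP) => [wT|[u ->]].
  exists (\row_i coord T i w); rewrite {1}(coord_span wT) mulmx_sum_row.
  by apply: eq_bigr => i _; rewrite rowK mxE (tnth_nth 0).
rewrite mulmx_sum_row memv_suml // => i _; rewrite memvZ // rowK.
by rewrite memv_span // mem_tnth.
Qed.

Definition rows_tuple (X : 'M[F]_(p, m)) : p.-tuple 'rV[F]_m := [tuple row i X | i < p].

Lemma rows_tupleK (X : 'M[F]_(p, m)) : \matrix_i tnth (rows_tuple X) i = X.
Proof. by apply/row_matrixP => i; rewrite rowK tnth_mktuple. Qed.

Lemma wedge_rows_tuple (X : 'M[F]_(p, m)) : wedge_rows X = wedge_seq (rows_tuple X).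
Proof. by rewrite wedge_seq_rows rows_tupleK. Qed.

Lemma mem_rows_tuple (X : 'M[F]_(p, m)) w :
  reflect (exists u : 'rV_p, w = u *m X) (w \in <<rows_tuple X>>%VS).
Proof. by have := mem_span_rows (rows_tuple X) w; rewrite rows_tupleK. Qed.

Lemma free_rows_tuple (X : 'M[F]_(p, m)) (f : 'I_p -> 'I_m) :
  colsub f X = 1%:M -> free (rows_tuple X).
Proof.
move=> fX; apply/freeP => k k0 i.
have : (\row_j k j) *m X = 0.
  rewrite -k0 mulmx_sum_row; apply: eq_bigr => j _.
  by rewrite mxE -tnth_nth tnth_mktuple.
move/(congr1 (colsub f)); rewrite -mulmx_colsub fX mulmx1 => /rowP/(_ i).
by rewrite !mxE.
Qed.

Lemma wedge_rows_neq0_minor (X : 'M[F]_(p, m)) :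
  wedge_rows X != 0 -> exists f : {ffun 'I_p -> 'I_m}, \det (colsub f X) != 0.
Proof.
move=> X0; have [I XI] : exists I, wedge_rows X I != 0.
  apply/existsP; apply: contraNT X0; rewrite negb_exists => /forallP X0.
  by apply/eqP/ffunP => I; rewrite ffunE; apply/eqP; have := X0 I; rewrite negbK.
have eI : #|I| = p.
  apply: contra_neq_eq XI => nI.
  by rewrite wedge_rows_seq wedge_seq_homog // size_map size_enum_ord.
move: X X0 XI; case: _ / eI => X _; rewrite wedge_rows_minor => d0.
exists [ffun i => enum_val i]; apply: contraNneq d0 => <-; apply/eqP.
by congr (\det _); apply/matrixP => i j; rewrite !mxE ffunE.
Qed.

(** The selected matrix differs from the identity only in column i, so expanding along row i leaves
    its diagonal entry. This is the form of Cramer's rule that expresses entries as minors. *)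
Lemma det_colsub_replace (R : comNzRingType) (X : 'M[R]_(p, m)) (f : 'I_p -> 'I_m) i j :
  colsub f X = 1%:M -> \det (colsub [ffun k => if k == i then j else f k] X) = X i j.
Proof.
move=> fX; set Z := colsub _ X.
have Zi k l : l != i -> Z k l = (k == l)%:R.
  by move=> li; move/matrixP/(_ k l): fX; rewrite !mxE ffunE (negPf li).
rewrite (expand_det_row Z i) (bigD1 i) //= big1 => [|l li]; last first.
  by rewrite Zi // eq_sym (negPf li) mul0r.
rewrite /cofactor addnn -signr_odd odd_double expr0 mul1r addr0.
have -> : row' i (col' i Z) = 1%:M.
  apply/matrixP => a b; rewrite [LHS]mxE [LHS]mxE Zi ?(eq_sym _ i) ?neq_lift //.
  by rewrite mxE (inj_eq lift_inj).
by rewrite det1 mulr1 mxE ffunE eqxx.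
Qed.
End Rows.

(** * Change of scalars *)

Section MapExt.
Context {R S : comNzRingType} {p m : nat} (h : {rmorphism R -> S}).

Lemma map_wedge (u w : ext R m) (u' w' : ext S m) :
  (forall I, u' I = h (u I)) -> (forall I, w' I = h (w I)) ->
  forall I, (u' ∧ w') I = h ((u ∧ w) I).
Proof.
move=> hu hw I; rewrite !ffunE rmorph_sum; apply: eq_bigr => J _.
by rewrite rmorphM rmorph_sign rmorphM hu hw.
Qed.

Lemma map_wedge_rows (X : 'M[R]_(p, m)) I : wedge_rows (map_mx h X) I = h (wedge_rows X I).
Proof.
move: I; rewrite /wedge_rows.
apply: (big_rec2 (fun (u : ext S m) (w : ext R m) => forall I, u I = h (w I))) => [I|i u w _ IH].
  by rewrite !ffunE rmorph_nat.
apply: map_wedge => // I; rewrite !ffunE rmorph_sum.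
by apply: eq_bigr => j _; rewrite !mxE.
Qed.

Lemma map_mpoly_meval (f : {mpoly R[m]}) (x : 'I_m -> R) :
  (map_mpoly h f).@[fun i => h (x i)] = h f.@[x].
Proof.
rewrite [in RHS]mevalE rmorph_sum /map_mpoly /mmap raddf_sum /=.
apply: eq_bigr => k _; rewrite mevalM mevalC mmap1_id mevalX rmorphM rmorph_prod.
by congr (_ * _); apply: eq_bigr => i _; rewrite rmorphXn.
Qed.

End MapExt.

(** * Lattices and special fibres *)

Section Lattice.
Context {R : idomainType} {kappa : fieldType}.
Context {v : discrete_valuation {fraction R}} {res : {rmorphism R -> kappa}} {t : R}.
Context (hR : is_valuation_ring v) (hres : is_residue_map res) (ht : is_uniformiser v t).
Context {m : nat}.
Implicit Types (A B : {vspace 'rV[{fraction R}]_m}).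

Local Notation frac := (@tofrac R).

Definition echelon_basis A (f : 'I_(\dim A) -> 'I_m) (X : 'M[R]_(\dim A, m)) : Prop :=
  colsub f X = 1%:M /\ <<rows_tuple (map_mx frac X)>>%VS =i A.

(* Divide a basis matrix of A by its nonzero maximal minor of least valuation: *)
(* by Cramer the entries become quotients of minors, hence integral.           *)
Lemma exists_echelon_basis A : exists f X, @echelon_basis A f X.
Proof.
pose M := \matrix_i tnth (vbasis A) i.
have A_M : A = <<vbasis A>>%VS by rewrite (span_basis (vbasisP A)).
have [f0 Pf0] : exists f : {ffun 'I_(\dim A) -> 'I_m}, \det (colsub f M) != 0.
  apply: wedge_rows_neq0_minor; rewrite -wedge_seq_rows.
  exact: wedge_seq_basis_neq0 (vbasisP A).
pose d (f : {ffun 'I_(\dim A) -> 'I_m}) := \det (colsub f M).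
case: (Order.TotalTheory.arg_minP (P := fun f => d f != 0) (fun f => v (d f)) Pf0).
move=> f df minf; pose Y := invmx (colsub f M) *m M.
have uM : colsub f M \in unitmx by rewrite unitmxE unitfE.
have M_Y : M = colsub f M *m Y by rewrite mulKVmx.
have fY : colsub f Y = 1%:M by rewrite -mulmx_colsub mulVmx.
have [X /matrixP X_Y] : exists X : 'M[R]_(\dim A, m), map_mx frac X = Y.
  have [|X HX] := @fin_all_exists _ (fun=> R) (fun ij r => Y ij.1 ij.2 = frac r).
    (* Zero entries are set apart because the value of [v] at 0 is unconstrained. The replaced
       selection [f'] may fail to be increasing, so the minimum is taken over all selections. *)
    move=> [i j] /=; have [->|Yij] := eqVneq (Y i j) 0; first by exists 0; rewrite tofrac0.
    apply: (dval_integral hR); pose f' := [ffun k => if k == i then j else f k].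
    have Ed : d f' = d f * Y i j.
      by rewrite -(det_colsub_replace i j fY) /d -det_mulmx mulmx_colsub -M_Y.
    have := minf f'; rewrite Ed mulf_neq0 // dvalM // lerDl.
    exact.
  exists (\matrix_(i, j) X (i, j)); apply/matrixP => i j; rewrite 2!mxE.
  exact/esym/(HX (i, j)).
have {}X_Y : map_mx frac X = Y by apply/matrixP.
exists f, X; split.
  apply/matrixP => i j; apply: tofrac_inj; move/matrixP/(_ i j): fY.
  by rewrite -X_Y !mxE => ->; case: eqP; rewrite ?tofrac1 ?tofrac0.
move=> w; rewrite [in RHS]A_M X_Y; apply/mem_rows_tuple/mem_span_rows => -[u ->].
  by exists (u *m invmx (colsub f M)); rewrite -mulmxA.
by exists (u *m colsub f M); rewrite -mulmxA -M_Y.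
Qed.

(** The coordinates of a lattice vector are its own entries in the columns [f], hence integral and
    unique. *)
Lemma echelon_basis_lattice A f X : @echelon_basis A f X -> lattice_basis X.
Proof.
case=> fX A_X; split=> [i|x].
  rewrite inE /= -A_X map_row; apply/mem_rows_tuple.
  by exists (delta_mx 0 i); rewrite -rowE.
rewrite inE /= -A_X => /mem_rows_tuple[u xu].
have eu : map_mx frac (colsub f x) = u.
  rewrite -[RHS]mulmx1 -[1%:M](_ : map_mx frac (colsub f X) = _).
    by rewrite !map_mxsub mulmx_colsub -xu.
  by rewrite fX map_mx1.
exists (colsub f x); split=> [|u' ->].
  apply/rowP => j; apply: tofrac_inj; move/rowP/(_ j): xu.
  by rewrite -eu -map_mxM !mxE.
by rewrite -mulmx_colsub fX mulmx1.
Qed.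

Lemma echelon_basis_of A f X : @echelon_basis A f X ->
  basis_of A (rows_tuple (map_mx frac X)).
Proof.
case=> fX A_X; rewrite basisEfree; apply/and3P; split.
- by apply: (@free_rows_tuple _ _ _ _ f); rewrite -map_mxsub fX map_mx1.
- by apply/subvP => w; rewrite A_X.
- by rewrite size_tuple.
Qed.

(** A reduced combination of rows lifts to a lattice vector, where every equation of the closure
    vanishes; conversely the linear equations given by the identity block already cut out the row
    space. *)
Lemma special_fibre_echelon A f X : @echelon_basis A f X ->
  special_fibre res A = <<rows_tuple (map_mx res X)>>%VS.
Proof.
case=> fX A_X; set W := span _.
have WP : is_special_fibre res A W.
  move=> y; split=> [/mem_rows_tuple[u ->] g [_ gA]|Hy].
    have [i|U EU] := @fin_all_exists _ (fun=> R) (fun i r => res r = u 0 i).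
      exact: (proj1 hres).
    pose x := (\row_i U i) *m X.
    have -> : u *m map_mx res X = map_mx res x.
      by rewrite map_mxM; congr (_ *m _); apply/rowP => i; rewrite !mxE.
    have gx : g.@[fun i => x 0 i] = 0.
      apply: tofrac_inj; rewrite tofrac0 -map_mpoly_meval.
      rewrite -[RHS](gA (map_mx frac x)); last first.
        by rewrite -A_X; apply/mem_rows_tuple; exists (map_mx frac (\row_i U i)); rewrite map_mxM.
      by apply: meval_eq => i; rewrite [RHS]mxE.
    rewrite -[RHS](rmorph0 res) -gx -map_mpoly_meval.
    by apply: meval_eq => i; rewrite [LHS]mxE.
  apply/mem_rows_tuple; exists (colsub f y); apply/rowP => j.
  (* On the row space, coordinate j is determined by the coordinates in the columns [f]. *)
  pose g : {mpoly R[m]} := 'X_j - \sum_i X i j *: 'X_(f i).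
  have gE (S : comNzRingType) (h : {rmorphism R -> S}) (z : 'I_m -> S) :
      (map_mpoly h g).@[z] = z j - \sum_i h (X i j) * z (f i).
    have -> : map_mpoly h g = 'X_j - \sum_i h (X i j) *: 'X_(f i).
      transitivity (map_mpoly h 'X_j - \sum_i map_mpoly h (X i j *: 'X_(f i))).
        by rewrite rmorphB rmorph_sum.
      rewrite map_mpolyX; congr (_ + - _).
      apply: eq_bigr => i _; apply: (etrans (map_mpolyZ _ _ _)).
      by congr (_ *: _); apply: map_mpolyX.
    rewrite mevalB mevalXU; congr (_ - _).
    rewrite (raddf_sum (meval z)); apply: eq_bigr => i _.
    by rewrite [LHS]mevalZ mevalXU.
  have /Hy : closure_equation A g.
    split.
      exists 1%N; rewrite rpredB ?rpred_sum // => [|i _].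
        by rewrite dhomogX; apply/eqP; exact: mdeg1.
      by rewrite dhomogZ // dhomogX; apply/eqP; exact: mdeg1.
    move=> x; rewrite -A_X => /mem_rows_tuple[u ->]; rewrite gE.
    apply/eqP; rewrite subr_eq0 mxE; apply/eqP/eq_bigr => i _.
    rewrite mulrC mxE; congr (_ * _).
    have : colsub f (u *m map_mx frac X) = u.
      by rewrite -mulmx_colsub -map_mxsub fX map_mx1 mulmx1.
    by move/rowP/(_ i); rewrite mxE.
  rewrite gE => /eqP; rewrite subr_eq0 => /eqP ->; rewrite mxE.
  by apply: eq_bigr => i _; rewrite mulrC !mxE.
(* [is_special_fibre] fixes the points of the subspace, so the chosen one coincides with [W]. *)
have := epsilon_spec (inhabits 0%VS) (is_special_fibre res A) (ex_intro _ W WP).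
rewrite -/(special_fibre res A) => sP; apply/vspaceP => y.
by apply/idP/idP => [/sP/WP|/WP/sP].
Qed.

Lemma echelon_basis_special A f X : @echelon_basis A f X ->
  basis_of (special_fibre res A) (rows_tuple (map_mx res X)).
Proof.
move=> eX; rewrite (special_fibre_echelon eX) basisEfree subvv size_tuple.
rewrite andTb; apply/andP; split; last first.
  by rewrite -[X in (_ <= X)%N](size_tuple (rows_tuple (map_mx res X))) dim_span.
by apply: (@free_rows_tuple _ _ _ _ f); rewrite -map_mxsub (proj1 eX) map_mx1.
Qed.

(** Each basis is an R-combination of the other; uniqueness of coordinates makes the two matrices
    inverse, so their determinants are units. *)
Lemma lattice_basis_change A (X X' : 'M[R]_(\dim A, m)) :
  lattice_basis X -> lattice_basis X' ->
  exists2 g : 'M_(\dim A), \det g \is a GRing.unit & X' = g *m X.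
Proof.
have coords (Y Y' : 'M[R]_(\dim A, m)) : lattice_basis Y -> lattice_basis Y' ->
    exists g : 'M_(\dim A), Y' = g *m Y.
  move=> [_ Yc] [Y'A _].
  have [|u Eu] := @fin_all_exists _ (fun=> 'rV[R]_(\dim A)) (fun i u => row i Y' = u *m Y).
    by move=> i; have [u [Eu _]] := Yc _ (Y'A i); exists u.
  exists (\matrix_i u i); apply/row_matrixP => i.
  by rewrite row_mul rowK.
move=> bX bX'; have [g Eg] := coords _ _ bX bX'; have [h Eh] := coords _ _ bX' bX.
exists g => //; apply/unitrP; exists (\det h).
suff hg : h *m g = 1%:M by rewrite -!det_mulmx (mulmx1C hg) hg det1.
apply/row_matrixP => i; have [_ Xc] := bX.
have [u [_ uP]] := Xc _ ((proj1 bX) i).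
rewrite -(uP (row i (h *m g))); last by rewrite -row_mul -mulmxA -Eg -Eh.
by apply: uP; rewrite -row_mul mul1mx.
Qed.

End Lattice.

(** * The limit perturbation *)

Section LimitPerturbation.
Context {R : idomainType} {kappa : fieldType}.
Context {v : discrete_valuation {fraction R}} {res : {rmorphism R -> kappa}} {t : R}.
Context (hR : is_valuation_ring v) (hres : is_residue_map res) (ht : is_uniformiser v t).
Context {m : nat}.
Implicit Types (A B : {vspace 'rV[{fraction R}]_m}).

Local Notation frac := (@tofrac R).

Lemma star0 (F : fieldType) (A B : {vspace 'rV[F]_m}) (a b : ext F m) :
  star a b (0 : perturbation A B) = 0.
Proof.
rewrite /star zero_lfunE linear0; apply/ffunP => I; rewrite !ffunE big1 // => J _.
by rewrite [X in _ * (_ * X)]ffunE !mulr0.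
Qed.

Lemma tofrac_det_psi p q (X : 'M[R]_(p, m)) (Y : 'M[R]_(q, m)) :
  frac (det_psi X Y) = (wedge_rows (map_mx frac X) ∧ wedge_rows (map_mx frac Y)) setT.
Proof.
apply/esym/(map_wedge (h := frac)) => I; exact: map_wedge_rows.
Qed.

(** Over K the rows of X and Y together form a basis of the whole space. *)
Lemma det_psi_neq0 A B f g (X : 'M[R]_(\dim A, m)) (Y : 'M[R]_(\dim B, m)) :
  (A :&: B = 0)%VS -> (\dim A + \dim B)%N = m ->
  echelon_basis f X -> echelon_basis g Y -> det_psi X Y != 0.
Proof.
move=> AB0 dAB eX eY; rewrite -tofrac_eq0 tofrac_det_psi !wedge_rows_tuple -wedge_seq_cat.
apply: wedge_seq_full_neq0; have <- : (A + B = fullv)%VS.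
  apply/eqP; rewrite eqEdim subvf dim_fullv dimv_disjoint_sum //.
  by rewrite dAB leqnn.
apply: cat_basis (echelon_basis_of eX) (echelon_basis_of eY).
exact/directv_addP.
Qed.

(** One pair of echelon bases determines a candidate through [exists_star]; it then satisfies the
    defining equation for every pair of lattice bases. *)
Lemma limit_perturbationP A B f g (X : 'M[R]_(\dim A, m)) (Y : 'M[R]_(\dim B, m)) :
  echelon_basis f X -> echelon_basis g Y -> det_psi X Y != 0 ->
  is_limit_perturbation v t (limit_perturbation v res t A B).
Proof.
move=> eX eY d0; apply: epsilon_spec.
have bX := echelon_basis_special hres eX; have bY := echelon_basis_special hres eY.
have fd0 : frac (det_psi X Y) != 0 by rewrite tofrac_eq0.
have [||||c Ec] := @exists_star _ _ (special_fibre res A) (special_fibre res B)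
  (wedge_rows (map_mx res X)) (wedge_rows (map_mx res Y)) (regt v res t (frac (det_psi X Y))).
- by rewrite (detv_basis bX) wedge_rows_tuple memv_line.
- by rewrite (detv_basis bY) wedge_rows_tuple memv_line.
- by rewrite wedge_rows_tuple (wedge_seq_basis_neq0 bX).
- by rewrite wedge_rows_tuple (wedge_seq_basis_neq0 bY).
exists c; split.
  (* A zero perturbation would make reg_t of the determinant vanish. *)
  apply: contraNneq (regt_neq0 hR hres ht fd0) => c0; move: Ec; rewrite c0 star0.
  move/ffunP/(_ setT); rewrite !ffunE eqxx => /esym/eqP.
  by rewrite [_ *: _]mulr1.
(* Both sides scale by the residue of det a det b: this is a unit, so its valuation is 0 and reg_t
   sends it to its residue. *)
move=> X' Y' lX' lY'.
have [a ua ->] := lattice_basis_change (echelon_basis_lattice eX) lX'.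
have [b ub ->] := lattice_basis_change (echelon_basis_lattice eY) lY'.
have -> : det_psi (a *m X) (b *m Y) = \det a * \det b * det_psi X Y.
  by rewrite /det_psi !wedge_rows_mulmx wedgeZl wedgeZr scalerA ffunE.
rewrite !map_mxM !wedge_rows_mulmx starZ Ec scalerA; congr (_ *: _).
have uab : \det a * \det b \is a GRing.unit by rewrite unitrM ua ub.
have uab0 : frac (\det a * \det b) != 0.
  by rewrite tofrac_eq0; apply: contraTneq uab => ->; rewrite unitr0.
rewrite tofracM (regtM hR ht uab0 fd0) (regt_unit hR uab).
by rewrite rmorphM !det_map_mx.
Qed.

End LimitPerturbation.

(** * Comparison of the two cross-ratios *)

Theorem theoremC (R : idomainType) (kappa : fieldType)
    (v : discrete_valuation {fraction R}) (res : {rmorphism R -> kappa}) (t : R)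
    (hR : is_valuation_ring v) (hres : is_residue_map res) (ht : is_uniformiser v t)
    (n k : nat) (A1 A2 B1 B2 : {vspace 'rV[{fraction R}]_n.+1})
    (hAB : complementary_configuration k A1 A2 B1 B2) :
  regt v res t (cross_ratio A1 A2 B1 B2) =
    deg_cross_ratio (special_fibre res A1) (special_fibre res A2)
                    (special_fibre res B1) (special_fibre res B2)
                    (limit_perturbation v res t A1 B1)
                    (limit_perturbation v res t A1 B2)
                    (limit_perturbation v res t A2 B1)
                    (limit_perturbation v res t A2 B2) /\
  regt v res t (cross_ratio A1 A2 B1 B2) != 0.
Proof.
case: hAB => -[dA1 dA2 dB1 dB2] [I11 I12 I21 I22].
have [f1 [X1 eX1]] := exists_echelon_basis hR A1.
have [f2 [X2 eX2]] := exists_echelon_basis hR A2.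
have [g1 [Y1 eY1]] := exists_echelon_basis hR B1.
have [g2 [Y2 eY2]] := exists_echelon_basis hR B2.
have d11 : det_psi X1 Y1 != 0 by apply: det_psi_neq0 eX1 eY1; rewrite // dA1 addnC.
have d12 : det_psi X1 Y2 != 0 by apply: det_psi_neq0 eX1 eY2; rewrite // dA1 addnC.
have d21 : det_psi X2 Y1 != 0 by apply: det_psi_neq0 eX2 eY1; rewrite // dA2 addnC.
have d22 : det_psi X2 Y2 != 0 by apply: det_psi_neq0 eX2 eY2; rewrite // dA2 addnC.
have gen A f X : @echelon_basis R n.+1 A f X ->
    wedge_rows (map_mx (@tofrac R) X) \in detv A /\ wedge_rows (map_mx (@tofrac R) X) != 0.
  move=> eX; have bX := echelon_basis_of eX; rewrite wedge_rows_tuple.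
  by rewrite (detv_basis bX) memv_line (wedge_seq_basis_neq0 bX).
have gens A f X : @echelon_basis R n.+1 A f X ->
    wedge_rows (map_mx res X) \in detv (special_fibre res A) /\ wedge_rows (map_mx res X) != 0.
  move=> eX; have bX := echelon_basis_special hres eX; rewrite wedge_rows_tuple.
  by rewrite (detv_basis bX) memv_line (wedge_seq_basis_neq0 bX).
have [x1 x1n] := gen _ _ _ eX1; have [x2 x2n] := gen _ _ _ eX2.
have [y1 y1n] := gen _ _ _ eY1; have [y2 y2n] := gen _ _ _ eY2.
have [z1 z1n] := gens _ _ _ eX1; have [z2 z2n] := gens _ _ _ eX2.
have [w1 w1n] := gens _ _ _ eY1; have [w2 w2n] := gens _ _ _ eY2.
rewrite (cross_ratioE x1 x2 y1 y2) // (deg_cross_ratioE _ _ _ _ z1 z2 w1 w2) //.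
(* On the reduced echelon bases, [star] at the limit perturbation is reg_t of the integral
   determinant times the standard generator of det V. *)
have L A B f g X Y (eX : @echelon_basis R n.+1 A f X) (eY : @echelon_basis R n.+1 B g Y) d0 :=
  proj2 (limit_perturbationP hR hres ht eX eY d0) _ _
    (echelon_basis_lattice eX) (echelon_basis_lattice eY).
rewrite (L _ _ _ _ _ _ eX1 eY1 d11) (L _ _ _ _ _ _ eX1 eY2 d12).
rewrite (L _ _ _ _ _ _ eX2 eY1 d21) (L _ _ _ _ _ _ eX2 eY2 d22).
have ratio_top (c d : kappa) : Defs.ratio (c *: ext_top kappa n.+1) (d *: ext_top kappa n.+1) = c / d.
  by rewrite ratioZ /Defs.ratio ffunE eqxx divr1 mulr1.
(* Only the four determinants and their regularised values remain. *)
rewrite !ratio_top /Defs.ratio -!tofrac_det_psi.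
have frac_neq0 (r : R) : r != 0 -> tofrac r != 0 by rewrite tofrac_eq0.
have {}d11 := frac_neq0 _ d11; have {}d12 := frac_neq0 _ d12.
have {}d21 := frac_neq0 _ d21; have {}d22 := frac_neq0 _ d22.
split; last by rewrite (regt_neq0 hR hres ht) // !mulf_neq0 ?invr_eq0.
by rewrite (regtM hR ht) ?mulf_neq0 ?invr_eq0 // !(regt_div hR hres ht).
Qed.
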